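(* Let $P$ be an LCM monoid and let $\mathcal{S}_P=\{[p,q,r]: p,q,r\in P,\ q\in rP\cap Pp\}\cup\{0\}$ be its associated inverse semigroup. Then $\mathcal{S}_P$ is $E^*$-unitary.
   Context: An LCM monoid is a cancellative (left and right) monoid $P$ such that for all $p,q\in P$: $pP\cap qP$ is either empty or equal to $rP$ for some $r\in P$, and $Pp\cap Pq$ is either empty or equal to $Pr$ for some $r\in P$. $U(P)$ denotes the group of invertible elements of $P$. On $P\times P\times P$ put $(p,q,r)\sim(a,b,c)$ iff there exist $u,v\in U(P)$ with $p=au$, $q=vbu$, $r=vc$; let $[p,q,r]$ denote the class. $\mathcal{S}_P$ is an inverse semigroup with zero $0$, with $[p,q,r]^*=[r_1,q,p_1]$ where $q=rr_1=p_1p$, and product $[p,q,r][a,b,c]=[pq_1,\,r_1raa_1,\,b_1c]$ if $raP\cap qP=kP$ with $raa_1=qq_1=k$ and $Pra\cap Pb=Pl$ with $r_1ra=b_1b=l$ for some $k,l,a_1,q_1,r_1,b_1\in P$, and $[p,q,r][a,b,c]=0$ if $raP\cap qP$ or $Pra\cap Pb$ is empty. An inverse semigroup $S$ with zero is $E^*$-unitary if whenever $s\in S$ and $e$ is a nonzero idempotent with $se=e$, then $s$ is an idempotent. *)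

(* Defs.v *)
From HB Require Import structures.
From mathcomp Require Import all_boot.
From mathcomp Require Import boolp classical_sets.

Set Implicit Arguments.
Unset Strict Implicit.
Unset Printing Implicit Defensive.

Local Open Scope classical_set_scope.
Local Open Scope quotient_scope.
Local Open Scope group_scope.

Section Ideals.
Variable P : monoidType.

(* pP *)
Definition right_ideal (p : P) : set P := [set x | exists y, x = p * y].

(* Pp *)
Definition left_ideal (p : P) : set P := [set x | exists y, x = y * p].

Definition invertible (u : P) : Prop := exists v, u * v = 1 /\ v * u = 1.

End Ideals.

HB.mixin Record Monoid_isLCM P of Monoid P := {
  lcm_mulgI : forall p x y : P, p * x = p * y -> x = y;
  lcm_mulIg : forall p x y : P, x * p = y * p -> x = y;
  right_lcm : forall p q : P,
    right_ideal p `&` right_ideal q = set0 \/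
    exists r, right_ideal p `&` right_ideal q = right_ideal r;
  left_lcm : forall p q : P,
    left_ideal p `&` left_ideal q = set0 \/
    exists r, left_ideal p `&` left_ideal q = left_ideal r
}.

#[short(type="lcmMonoidType")]
HB.structure Definition LCMMonoid := {P of Monoid_isLCM P & Monoid P}.

HB.mixin Record Semigroup_isInverseWithZero S of Semigroup S := {
  star : S -> S;
  mul_star_mul : forall s : S, s * star s * s = s;
  star_mul_star : forall s : S, star s * s * star s = star s;
  star_unique : forall s t : S, s * t * s = s -> t * s * t = t -> t = star s;
  zero : S;
  mul0s : forall s : S, zero * s = zero;
  muls0 : forall s : S, s * zero = zero
}.

#[short(type="inverseSemigroup0Type")]
HB.structure Definition InverseSemigroup0 :=
  {S of Semigroup_isInverseWithZero S & Semigroup S}.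

Definition idempotent_elt (S : semigroupType) (s : S) : Prop := s * s = s.

Definition Estar_unitary (S : inverseSemigroup0Type) : Prop :=
  forall s e : S,
    idempotent_elt e -> e <> zero -> s * e = e -> idempotent_elt s.

Section Carrier.
Variable P : monoidType.

Definition triple_equiv : rel (P * P * P) := fun x y =>
  let: (p, q, r) := x in let: (a, b, c) := y in
  `[< exists u v, [/\ invertible u, invertible v,
        p = a * u, q = v * b * u & r = v * c] >].

Lemma triple_equivP p q r a b c :
  reflect (exists u v, [/\ invertible u, invertible v,
             p = a * u, q = v * b * u & r = v * c])
          (triple_equiv (p, q, r) (a, b, c)).
Proof. exact: asboolP. Qed.

Lemma invertible1 : invertible (1 : P).
Proof. by exists 1; rewrite mulg1. Qed.

Lemma invertibleM (u v : P) : invertible u -> invertible v -> invertible (u * v).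
Proof.
move=> [u' [uu' u'u]] [v' [vv' v'v]]; exists (v' * u'); split.
  by rewrite mulgA -(mulgA u) vv' mulg1.
by rewrite mulgA -(mulgA v') u'u mulg1.
Qed.

Lemma triple_equiv_refl : reflexive triple_equiv.
Proof.
move=> [[p q] r]; apply/triple_equivP; exists 1, 1.
by split; rewrite ?mul1g ?mulg1 //; exact: invertible1.
Qed.

Lemma triple_equiv_imp_sym x y : triple_equiv x y -> triple_equiv y x.
Proof.
case: x y => [[p q] r] [[a b] c] /triple_equivP[u [v [[u' [uu' u'u]]]]].
case=> v' [vv' v'v] -> -> ->; apply/triple_equivP; exists u', v'.
split; first by exists u.
- by exists v.
- by rewrite -mulgA uu' mulg1.
- by rewrite !mulgA v'v mul1g -mulgA uu' mulg1.
- by rewrite mulgA v'v mul1g.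
Qed.

Lemma triple_equiv_sym : symmetric triple_equiv.
Proof. by move=> x y; apply/idP/idP; exact: triple_equiv_imp_sym. Qed.

Lemma triple_equiv_trans : transitive triple_equiv.
Proof.
move=> [[a b] c] [[p q] r] [[i j] k] /triple_equivP[u [v [iu iv -> -> ->]]].
move=> /triple_equivP[u' [v' [iu' iv' -> -> ->]]].
apply/triple_equivP; exists (u' * u), (v * v').
by split; rewrite ?mulgA //; exact: invertibleM.
Qed.

Canonical triple_equiv_equiv :=
  EquivRel triple_equiv triple_equiv_refl triple_equiv_sym triple_equiv_trans.

Definition triple_class := {eq_quot triple_equiv}.
HB.instance Definition _ := EqQuotient.on triple_class.

Lemma class_eqP x y :
  reflect (\pi_triple_class x = \pi_triple_class y) (triple_equiv x y).
Proof. by rewrite -(eqmodE triple_equiv_equiv); exact: eqP. Qed.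

Definition admissible (x : triple_class) : bool :=
  `[< exists p q r, x = \pi_triple_class (p, q, r) /\
        (right_ideal r `&` left_ideal p) q >].

(* [None] is the zero *)
Definition lcm_semigroup : Type := option {x : triple_class | admissible x}.
HB.instance Definition _ := Choice.on lcm_semigroup.

Definition lcm_zero : lcm_semigroup := None.

(* The element [p,q,r]; it is only meaningful when q is in rP and in Pp
   (otherwise it is sent to the zero). *)
Definition cls (p q r : P) : lcm_semigroup :=
  insub (\pi_triple_class (p, q, r)).

(* The product and the star as relations, transcribing their definition on
   representatives; [lcm_prod_total], [lcm_prod_functional] and their
   counterparts for the star show that they are operations. *)
Inductive lcm_prod : lcm_semigroup -> lcm_semigroup -> lcm_semigroup -> Prop :=
| lcm_prod_cls p q r a b c k l a1 q1 r1 b1 :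
    (right_ideal r `&` left_ideal p) q ->
    (right_ideal c `&` left_ideal a) b ->
    right_ideal (r * a) `&` right_ideal q = right_ideal k ->
    r * a * a1 = k -> q * q1 = k ->
    left_ideal (r * a) `&` left_ideal b = left_ideal l ->
    r1 * (r * a) = l -> b1 * b = l ->
    lcm_prod (cls p q r) (cls a b c) (cls (p * q1) (r1 * r * a * a1) (b1 * c))
| lcm_prod_empty p q r a b c :
    (right_ideal r `&` left_ideal p) q ->
    (right_ideal c `&` left_ideal a) b ->
    right_ideal (r * a) `&` right_ideal q = set0 \/
      left_ideal (r * a) `&` left_ideal b = set0 ->
    lcm_prod (cls p q r) (cls a b c) lcm_zero
| lcm_prod_0s s : lcm_prod lcm_zero s lcm_zero
| lcm_prod_s0 s : lcm_prod s lcm_zero lcm_zero.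

Inductive lcm_star_rel : lcm_semigroup -> lcm_semigroup -> Prop :=
| lcm_star_cls p q r r1 p1 :
    q = r * r1 -> q = p1 * p ->
    lcm_star_rel (cls p q r) (cls r1 q p1)
| lcm_star_0 : lcm_star_rel lcm_zero lcm_zero.

Variant lcm_semigroup_spec : lcm_semigroup -> Type :=
| LcmZero : lcm_semigroup_spec lcm_zero
| LcmCls p q r r1 p1 of q = r * r1 & q = p1 * p :
    lcm_semigroup_spec (cls p q r).

Lemma cls_admissible p q r r1 p1 : q = r * r1 -> q = p1 * p ->
  admissible (\pi_triple_class (p, q, r)).
Proof.
move=> e1 e2; apply/asboolP; exists p, q, r; split=> //.
by split; [exists r1 | exists p1].
Qed.

Lemma lcm_semigroupP s : lcm_semigroup_spec s.
Proof.
case: s => [[x adx]|]; last exact: LcmZero.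
have /asboolP/cid[p /cid[q /cid[r [xE [/cid[r1 e1] /cid[p1 e2]]]]]] := adx.
suff -> : Some (exist _ x adx) = cls p q r by exact: LcmCls e1 e2.
by rewrite /cls -xE insubT.
Qed.

Lemma cls_neq0 p q r r1 p1 : q = r * r1 -> q = p1 * p -> cls p q r <> lcm_zero.
Proof.
by move=> e1 e2; rewrite /cls (insubT _ (cls_admissible e1 e2)).
Qed.

Lemma eq_cls p q r r1 p1 a b c c1 a1 :
  q = r * r1 -> q = p1 * p -> b = c * c1 -> b = a1 * a ->
  cls p q r = cls a b c <->
  exists u v, [/\ invertible u, invertible v,
                  p = a * u, q = v * b * u & r = v * c].
Proof.
move=> e1 e2 e3 e4; have ad := cls_admissible e1 e2.
have ad' := cls_admissible e3 e4.
rewrite /cls (insubT _ ad) (insubT _ ad'); split=> [[e]|/triple_equivP e].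
  exact/triple_equivP/class_eqP.
by congr Some; apply/val_inj/class_eqP.
Qed.

End Carrier.

Arguments lcm_zero {P}.

Section Operations.
Variable P : lcmMonoidType.
Local Notation SP := (lcm_semigroup P).
Local Notation mulgI := lcm_mulgI.
Local Notation mulIg := lcm_mulIg.

(* [p,q,r] with q = r r1 = p1 p acts on P x P as the partial bijection
   (x r, r1 y) |-> (x p1, p y). This is a faithful representation of S_P, from
   which the axioms of an inverse semigroup are deduced. *)
Definition act (s : SP) (z w : P * P) : Prop :=
  exists p r r1 p1 x y, [/\ r * r1 = p1 * p, s = cls p (r * r1) r,
    z = (x * r, r1 * y) & w = (x * p1, p * y)].

Lemma act_cls p q r r1 p1 z w : q = r * r1 -> q = p1 * p ->
  act (cls p q r) z w <->
  exists x y, z = (x * r, r1 * y) /\ w = (x * p1, p * y).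
Proof.
move=> e1 e2; split=> [|[x [y [-> ->]]]]; last first.
  by exists p, r, r1, p1, x, y; split; rewrite -?e1.
move=> [p' [r' [r1' [p1' [x [y [e se -> ->]]]]]]].
have /(eq_cls e1 e2 erefl e)[u [v [[u' [uu' u'u]] [v' [vv' v'v]] pE qE rE]]] := se.
have r1E : r1 = r1' * u.
  by apply: (mulgI r); rewrite -e1 qE rE !mulgA.
have p1E : p1 = v * p1'.
  by apply: (mulIg p); rewrite -e2 qE e pE !mulgA.
exists (x * v'), (u' * y); split; congr (_, _).
- by rewrite rE mulgA -(mulgA x) v'v mulg1.
- by rewrite r1E mulgA -(mulgA r1') uu' mulg1.
- by rewrite p1E mulgA -(mulgA x) v'v mulg1.
- by rewrite pE mulgA -(mulgA p') uu' mulg1.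
Qed.

Lemma act0 z w : ~ act lcm_zero z w.
Proof.
move=> [p [r [r1 [p1 [x [y [e /esym se _ _]]]]]]].
exact: cls_neq0 (erefl (r * r1)) e se.
Qed.

Lemma act_det s z w w' : act s z w -> act s z w' -> w = w'.
Proof.
case: (lcm_semigroupP s) => [/act0//|p q r r1 p1 e1 e2].
move=> /(act_cls _ _ e1 e2)[x [y [-> ->]]].
by move=> /(act_cls _ _ e1 e2)[x' [y' [[/mulIg -> /mulgI ->]]]] ->.
Qed.

Lemma act_inj s z z' w : act s z w -> act s z' w -> z = z'.
Proof.
case: (lcm_semigroupP s) => [/act0//|p q r r1 p1 e1 e2].
move=> /(act_cls _ _ e1 e2)[x [y [-> ->]]].
by move=> /(act_cls _ _ e1 e2)[x' [y' [-> [/mulIg -> /mulgI ->]]]].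
Qed.

Lemma act_faithful s t : (forall z w, act s z w <-> act t z w) -> s = t.
Proof.
case: (lcm_semigroupP s) => [|p q r r1 p1 e1 e2].
  case: (lcm_semigroupP t) => // a b c c1 a1 f1 f2 /(_ (c, c1) (a1, a))[_ H].
  suff /H /act0 : act (cls a b c) (c, c1) (a1, a) by [].
  by apply/(act_cls _ _ f1 f2); exists 1, 1; rewrite !mul1g !mulg1.
have acts : act (cls p q r) (r, r1) (p1, p).
  by apply/(act_cls _ _ e1 e2); exists 1, 1; rewrite !mul1g !mulg1.
case: (lcm_semigroupP t) => [/(_ (r, r1) (p1, p))[/(_ acts)/act0]//|].
move=> a b c c1 a1 f1 f2 H; apply/(eq_cls e1 e2 f1 f2).
have /(act_cls _ _ f1 f2)[v [u [[rE r1E] [p1E pE]]]] := (H _ _).1 acts.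
have actt : act (cls a b c) (c, c1) (a1, a).
  by apply/(act_cls _ _ f1 f2); exists 1, 1; rewrite !mul1g !mulg1.
have /(act_cls _ _ e1 e2)[v' [u' [[cE c1E] _]]] := (H _ _).2 actt.
exists u, v; split=> //.
- exists u'; split.
    by apply: (mulgI c1); rewrite mulgA -r1E -c1E mulg1.
  by apply: (mulgI r1); rewrite mulgA -c1E -r1E mulg1.
- exists v'; split.
    by apply: (mulIg r); rewrite -mulgA -cE -rE mul1g.
  by apply: (mulIg c); rewrite -mulgA -rE -cE mul1g.
- by rewrite e1 f1 rE r1E !mulgA.
Qed.

Lemma act_prod s t m z w : lcm_prod s t m ->
  act m z w <-> exists2 z', act t z z' & act s z' w.
Proof.
case=> {s t m}.
- move=> p q r a b c k l a1 q1 r1 b1 [[rho qE] [pi qE']] [[gam bE] [alp bE']].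
  move=> kP ek1 ek2 lP el1 el2.
  have raE : a * a1 = rho * q1.
    by apply: (mulgI r); rewrite !mulgA -qE ek1 ek2.
  have rbE : r1 * r = b1 * alp.
    by apply: (mulIg a); rewrite -!mulgA -bE' el1 el2.
  have m1 : r1 * r * a * a1 = (b1 * c) * (gam * a1).
    by rewrite -(mulgA r1) el1 -el2 bE !mulgA.
  have m2 : r1 * r * a * a1 = (r1 * pi) * (p * q1).
    by rewrite -!mulgA (mulgA r) ek1 -ek2 qE' !mulgA.
  rewrite (act_cls _ _ m1 m2); split.
    move=> [x [y [-> ->]]]; exists (x * b1 * alp, a * (a1 * y)).
      apply/(act_cls _ _ bE bE'); exists (x * b1), (a1 * y).
      by rewrite !mulgA.
    apply/(act_cls _ _ qE qE'); exists (x * r1), (q1 * y); split.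
      by rewrite -!mulgA rbE !mulgA raE.
    by rewrite !mulgA.
  move=> [_ /(act_cls _ _ bE bE')[x1 [y1 [-> ->]]]].
  move=> /(act_cls _ _ qE qE')[x2 [y2 [[ex ey] ->]]].
  have /= : left_ideal l (x1 * b).
    by rewrite -lP; split; [exists x2; rewrite bE' !mulgA ex | exists x1].
  move=> [x xl].
  have x1E : x1 = x * b1 by apply: (mulIg b); rewrite xl -el2 mulgA.
  have x2E : x2 = x * r1.
    by apply: (mulIg (r * a)); rewrite -mulgA el1 -xl bE' !mulgA ex.
  have /= : right_ideal k (q * y2).
    by rewrite -kP; split; [exists y1; rewrite qE -!mulgA ey | exists y2].
  move=> [y yk].
  have y2E : y2 = q1 * y by apply: (mulgI q); rewrite yk -ek2 mulgA.
  have y1E : y1 = a1 * y.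
    by apply: (mulgI (r * a)); rewrite mulgA ek1 -yk qE -!mulgA ey.
  by exists x, y; rewrite x1E x2E y1E y2E !mulgA.
- move=> p q r a b c [[rho qE] [pi qE']] [[gam bE] [alp bE']] H.
  split=> [/act0//|[_ /(act_cls _ _ bE bE')[x1 [y1 [-> ->]]]]].
  move=> /(act_cls _ _ qE qE')[x2 [y2 [[ex ey] _]]]; case: H => H.
    suff : set0 (q * y2) by [].
    by rewrite -H; split; [exists y1; rewrite qE -!mulgA ey | exists y2].
  suff : set0 (x1 * b) by [].
  by rewrite -H; split; [exists x2; rewrite bE' !mulgA ex | exists x1].
- by move=> s; split=> [/act0//|[z' _ /act0]].
- by move=> s; split=> [/act0//|[z' /act0]].
Qed.

Lemma lcm_prod_functional (s t m m' : SP) :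
  lcm_prod s t m -> lcm_prod s t m' -> m = m'.
Proof.
move=> H H'; apply: act_faithful => z w.
by rewrite (act_prod _ _ H) (act_prod _ _ H').
Qed.

Lemma lcm_prod_total (s t : SP) : exists m, lcm_prod s t m.
Proof.
case: (lcm_semigroupP s) => [|p q r rho pi e1 e2].
  by exists lcm_zero; exact: lcm_prod_0s.
case: (lcm_semigroupP t) => [|a b c gam alp f1 f2].
  by exists lcm_zero; exact: lcm_prod_s0.
have aq : (right_ideal r `&` left_ideal p) q by split; [exists rho | exists pi].
have ab : (right_ideal c `&` left_ideal a) b by split; [exists gam | exists alp].
have [ek|[k ek]] := right_lcm (r * a) q.
  by exists lcm_zero; apply: lcm_prod_empty => //; left.
have [el|[l el]] := left_lcm (r * a) b.
  by exists lcm_zero; apply: lcm_prod_empty => //; right.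
have : right_ideal k k by exists 1; rewrite mulg1.
rewrite -ek => -[[a1 ka1] [q1 kq1]].
have : left_ideal l l by exists 1; rewrite mul1g.
rewrite -el => -[[r1 lr1] [b1 lb1]].
exists (cls (p * q1) (r1 * r * a * a1) (b1 * c)).
by apply: (lcm_prod_cls aq ab ek _ _ el).
Qed.

Lemma act_star (s t : SP) z w : lcm_star_rel s t -> act t z w <-> act s w z.
Proof.
case=> {s t} [p q r r1 p1 e1 e2|]; last by split=> /act0.
rewrite (act_cls _ _ e1 e2) (act_cls _ _ e2 e1).
by split=> -[x [y [-> ->]]]; exists x, y.
Qed.

Lemma lcm_star_functional (s t t' : SP) :
  lcm_star_rel s t -> lcm_star_rel s t' -> t = t'.
Proof.
move=> H H'; apply: act_faithful => z w.
by rewrite (act_star _ _ H) (act_star _ _ H').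
Qed.

Lemma lcm_star_total (s : SP) : exists t, lcm_star_rel s t.
Proof.
case: (lcm_semigroupP s) => [|p q r r1 p1 e1 e2].
  by exists lcm_zero; exact: lcm_star_0.
by exists (cls r1 q p1); exact: lcm_star_cls.
Qed.

Definition lcm_mul (s t : SP) : SP := projT1 (cid (lcm_prod_total s t)).

Definition lcm_star (s : SP) : SP := projT1 (cid (lcm_star_total s)).

Lemma lcm_mulP (s t m : SP) : lcm_mul s t = m <-> lcm_prod s t m.
Proof.
rewrite /lcm_mul; case: cid => m' /= H; split=> [<- //|].
exact: lcm_prod_functional.
Qed.

Lemma lcm_starP (s t : SP) : lcm_star s = t <-> lcm_star_rel s t.
Proof.
rewrite /lcm_star; case: cid => t' /= H; split=> [<- //|].
exact: lcm_star_functional.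
Qed.

Lemma act_mul s t z w :
  act (lcm_mul s t) z w <-> exists2 z', act t z z' & act s z' w.
Proof. by apply: act_prod; apply/lcm_mulP. Qed.

Lemma act_lcm_star s z w : act (lcm_star s) z w <-> act s w z.
Proof. by apply: act_star; apply/lcm_starP. Qed.

Lemma lcm_mulA : associative lcm_mul.
Proof.
move=> s t m; apply: act_faithful => z w; rewrite !act_mul; split.
- move=> [z1 /act_mul[z2 mz tz] sz]; exists z2 => //.
  by apply/act_mul; exists z1.
- move=> [z1 mz /act_mul[z2 tz sz]]; exists z2 => //.
  by apply/act_mul; exists z1.
Qed.

HB.instance Definition _ := isSemigroup.Build SP lcm_mulA.

Lemma act_sts s t z w : act (lcm_mul (lcm_mul s t) s) z w <->
  exists z1 z2, [/\ act s z z1, act t z1 z2 & act s z2 w].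
Proof.
rewrite act_mul; split=> [[z1 sz /act_mul[z2 tz sz']]|[z1 [z2 [sz tz sz']]]].
  by exists z1, z2.
by exists z1 => //; apply/act_mul; exists z2.
Qed.

Lemma lcm_mul_star_mul (s : SP) : s * lcm_star s * s = s.
Proof.
apply: act_faithful => z w; rewrite act_sts; split.
  by move=> [z1 [z2 [s1 /act_lcm_star s2 s3]]]; rewrite (act_inj s1 s2).
by move=> sz; exists w, z; split=> //; apply/act_lcm_star.
Qed.

Lemma lcm_starK : involutive lcm_star.
Proof. by move=> s; apply: act_faithful => z w; rewrite !act_lcm_star. Qed.

Lemma lcm_star_mul_star (s : SP) : lcm_star s * s * lcm_star s = lcm_star s.
Proof. by rewrite -{2}[s]lcm_starK lcm_mul_star_mul. Qed.

Lemma act_sub_star (s t : SP) z w : s * t * s = s -> act s z w -> act t w z.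
Proof.
move=> e sz; have := sz; rewrite -{1}e => /act_sts[z1 [z2 [s1 t1 s2]]].
by rewrite (act_inj sz s2) (act_det sz s1).
Qed.

Lemma lcm_star_unique (s t : SP) :
  s * t * s = s -> t * s * t = t -> t = lcm_star s.
Proof.
move=> sts tst; apply: act_faithful => z w; rewrite act_lcm_star.
by split; exact: act_sub_star.
Qed.

Lemma lcm_mul0s (s : SP) : (lcm_zero : SP) * s = lcm_zero.
Proof. by apply/lcm_mulP; exact: lcm_prod_0s. Qed.

Lemma lcm_muls0 (s : SP) : s * lcm_zero = lcm_zero.
Proof. by apply/lcm_mulP; exact: lcm_prod_s0. Qed.

HB.instance Definition _ := Semigroup_isInverseWithZero.Build SP
  lcm_mul_star_mul lcm_star_mul_star lcm_star_unique lcm_mul0s lcm_muls0.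

End Operations.

(* Main.v *)
(* An element s = [p,q,r] with q = r r1 = p1 p acts on P x P as the partial
   bijection (x r, r1 y) |-> (x p1, p y). If s e = e for a nonzero idempotent e,
   then s fixes any point of the domain of e. By cancellation a single fixed
   point forces r = p1 and r1 = p, so that s acts as a partial identity. *)
Require Import Defs.
From HB Require Import structures.
From mathcomp Require Import all_boot.
From mathcomp Require Import boolp classical_sets.

(** Supplies the point at which [s * e = e] is tested. *)
Lemma act_nonempty (P : lcmMonoidType) (s : lcm_semigroup P) :
  s <> lcm_zero -> exists z w, act s z w.
Proof.
case: (lcm_semigroupP s) => [//|p q r r1 p1 e1 e2 _].
exists (1 * r, r1 * 1)%g, (1 * p1, p * 1)%g.
by apply/(act_cls _ _ e1 e2); exists 1%g, 1%g.
Qed.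

(** If [e * e] passes from [z] to [w] through [z'], determinism gives [z' = w], and injectivity then
    gives [z = z']. *)
Lemma act_idempotent (P : lcmMonoidType) (e : lcm_semigroup P) z w :
  idempotent_elt e -> act e z w -> z = w.
Proof.
move=> ee ezw; have := ezw; rewrite -{1}ee => /act_mul[z' ezz' ez'w].
by rewrite (act_det ezw ezz'); exact: act_inj ezw ez'w.
Qed.

Lemma act_fixed_point (P : lcmMonoidType) (s : lcm_semigroup P) z0 z w :
  act s z0 z0 -> act s z w -> z = w.
Proof.
case: (lcm_semigroupP s) => [/act0//|p q r r1 p1 e1 e2].
move=> /(act_cls _ _ e1 e2)[x0 [y0 [-> [/lcm_mulgI rp1 /lcm_mulIg r1p]]]].
by subst p1 p; move=> /(act_cls _ _ e1 e2)[x [y [-> ->]]].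
Qed.

(** A partial identity composed with itself is itself; faithfulness carries this back to [s]. *)
Lemma idempotent_act_id (P : lcmMonoidType) (s : lcm_semigroup P) :
  (forall z w, act s z w -> z = w) -> idempotent_elt s.
Proof.
move=> sid; apply: act_faithful => z w; rewrite act_mul; split.
  by move=> [z' /sid ->].
by move=> szw; have zw := sid _ _ szw; subst w; exists z.
Qed.

Theorem lemma2p24 (P : lcmMonoidType) : Estar_unitary (lcm_semigroup P).
Proof.
move=> s e ee /act_nonempty[z [w ezw]] se.
have zw := act_idempotent _ _ _ _ ee ezw; subst w.
(* Here [e] sends [z] to [z'] and [s] sends [z'] to [z]; as [e] fixes [z], so does [s]. *)
have := ezw; rewrite -{1}se => /act_mul[z' ezz' sz'z].
rewrite -(act_det ezw ezz') in sz'z.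
by apply: idempotent_act_id => z1 w1; exact: act_fixed_point sz'z.
Qed.
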